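(* Let $n\ge 1$, let $S\in\{\mathcal{CP}_n,\mathcal{ORCP}_n,\mathcal{OCP}_n\}$, and let $\alpha,\beta\in S$. Let $\mathcal{L}^*,\mathcal{R}^*,\mathcal{H}^*,\mathcal{D}^*$ denote the starred Green's relations on $S$. Then: (i) $\alpha\,\mathcal{L}^*\,\beta$ if and only if $\operatorname{Im}\alpha=\operatorname{Im}\beta$; (ii) $\alpha\,\mathcal{R}^*\,\beta$ if and only if $\ker\alpha=\ker\beta$; (iii) $\alpha\,\mathcal{H}^*\,\beta$ if and only if $\operatorname{Im}\alpha=\operatorname{Im}\beta$ and $\ker\alpha=\ker\beta$; (iv) $\alpha\,\mathcal{D}^*\,\beta$ if and only if $|\operatorname{Im}\alpha|=|\operatorname{Im}\beta|$.
   Context: Let $[n]=\{1,2,\dots,n\}$ with the usual order, and let $\mathcal{P}_n$ be the semigroup of all partial maps $\alpha$ with domain $\operatorname{Dom}\alpha\subseteq[n]$ and image $\operatorname{Im}\alpha\subseteq[n]$ (including the empty map). Maps are written on the right and composed left to right: $x(\alpha\beta)=(x\alpha)\beta$, defined for those $x\in\operatorname{Dom}\alpha$ with $x\alpha\in\operatorname{Dom}\beta$. A map $\alpha\in\mathcal{P}_n$ is a contraction if $|x\alpha-y\alpha|\le|x-y|$ for all $x,y\in\operatorname{Dom}\alpha$; it is order preserving (resp. order reversing) if for all $x,y\in\operatorname{Dom}\alpha$, $x\le y$ implies $x\alpha\le y\alpha$ (resp. $x\alpha\ge y\alpha$). $\mathcal{CP}_n$ is the semigroup of all contractions in $\mathcal{P}_n$;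 $\mathcal{OCP}_n$ is the subsemigroup of order preserving contractions; $\mathcal{ORCP}_n$ is the subsemigroup of contractions that are order preserving or order reversing. The kernel is $\ker\alpha=\{(x,y): x,y\in\operatorname{Dom}\alpha,\ x\alpha=y\alpha\}$, an equivalence relation on $\operatorname{Dom}\alpha$ (so $\ker\alpha=\ker\beta$ entails $\operatorname{Dom}\alpha=\operatorname{Dom}\beta$). For a semigroup $S$ (with $S^1$ denoting $S$ with an identity adjoined if necessary), the starred Green's relations are: $a\,\mathcal{L}^*\,b$ iff for all $x,y\in S^1$, $ax=ay\Leftrightarrow bx=by$ (equivalently, $a,b$ are $\mathcal{L}$-related in some oversemigroup of $S$); $a\,\mathcal{R}^*\,b$ iff for all $x,y\in S^1$, $xa=ya\Leftrightarrow xb=yb$ (equivalently, $a,b$ are $\mathcal{R}$-related in some oversemigroup of $S$); $\mathcal{H}^*=\mathcal{L}^*\cap\mathcal{R}^*$; $\mathcal{D}^*$ is the join of $\mathcal{L}^*$ and $\mathcal{R}^*$, i.e. the smallest equivalence relation containing both. *)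

(* Defs.v *)
From Stdlib Require Import Relations.
From HB Require Import structures.
From mathcomp Require Import all_boot ssrint.

Set Implicit Arguments.
Unset Strict Implicit.
Unset Printing Implicit Defensive.

Import IntDist.
Local Open Scope group_scope.

Section StarredGreen.
Variable S : semigroupType.
Implicit Types (a b s e : S) (x y : option S).

Definition has_identity : Prop := exists e, forall s, e * s = s /\ s * e = s.

(* S^1 is represented inside [option S]: [Some s] is the element s of S, and
   [None] is the adjoined identity, which belongs to S^1 only when S has no
   identity of its own. *)
Definition in_S1 x : Prop := if x is Some _ then True else ~ has_identity.

(* The products a x and x a in S^1; they lie in S because a does. *)
Definition mulS1 a x : S := if x is Some s then a * s else a.
Definition S1mul x a : S := if x is Some s then s * a else a.

Definition Lstar a b : Prop :=
  forall x y, in_S1 x -> in_S1 y ->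
    (mulS1 a x = mulS1 a y <-> mulS1 b x = mulS1 b y).

Definition Rstar a b : Prop :=
  forall x y, in_S1 x -> in_S1 y ->
    (S1mul x a = S1mul y a <-> S1mul x b = S1mul y b).

Definition Hstar a b : Prop := Lstar a b /\ Rstar a b.

Definition Dstar : relation S := clos_refl_sym_trans S (union S Lstar Rstar).

End StarredGreen.

Section Subsemigroup.
Variables (G : semigroupType) (S : mulgClosed G).

Definition subsemigroup : Type := {a : G | a \in S}.

HB.instance Definition _ := SubChoice.on subsemigroup.

Fact subsemigroup_mulg_closed : mulg_closed S.
Proof. exact: gpredM. Qed.

HB.instance Definition _ :=
  SubChoice_isSubSemigroup.Build G (fun a => a \in S) subsemigroup
    subsemigroup_mulg_closed.

End Subsemigroup.

(* The chain [n] is represented by 'I_n, i.e. shifted to {0, ..., n-1}; this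
   changes neither the order nor the distances. [a x = None] means that x is
   not in the domain of a. *)
Definition partial_map (n : nat) : Type := {ffun 'I_n -> option 'I_n}.

HB.instance Definition _ n := Finite.on (partial_map n).

Definition partial_map_fun n (a : partial_map n) : 'I_n -> option 'I_n :=
  fun_of_fin (a : {ffun 'I_n -> option 'I_n}).
Coercion partial_map_fun : partial_map >-> Funclass.

Definition pcomp n (a b : partial_map n) : partial_map n :=
  [ffun x => obind b (a x)].

Fact pcompE n (a b : partial_map n) x : pcomp a b x = obind b (a x).
Proof. exact: ffunE. Qed.

Fact pcompA n : associative (@pcomp n).
Proof.
by move=> a b c; apply/ffunP=> x; rewrite !ffunE pcompE; case: (a x) => //= y;
  rewrite pcompE.
Qed.

HB.instance Definition _ n := isSemigroup.Build (partial_map n) (@pcompA n).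

Fact partial_map_mulE n (a b : partial_map n) x : (a * b) x = obind b (a x).
Proof. exact: pcompE. Qed.

Section PartialMaps.
Variable n : nat.
Implicit Types a b : partial_map n.

Definition Dom a : {set 'I_n} := [set x | a x != None].

Definition Im a : {set 'I_n} := [set y | [exists x, a x == Some y]].

Definition Ker a : {set 'I_n * 'I_n} :=
  [set p | [&& p.1 \in Dom a, p.2 \in Dom a & a p.1 == a p.2]].

Definition contraction a : bool :=
  [forall x, forall y, forall u, forall v,
    (a x == Some u) && (a y == Some v) ==> (`|u - v| <= `|x - y|)%N].

Definition order_preserving a : bool :=
  [forall x, forall y, forall u, forall v,
    (a x == Some u) && (a y == Some v) ==> (x <= y)%N ==> (u <= v)%N].

Definition order_reversing a : bool :=
  [forall x, forall y, forall u, forall v,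
    (a x == Some u) && (a y == Some v) ==> (x <= y)%N ==> (v <= u)%N].

Definition CP : {pred partial_map n} := [pred a | contraction a].

Definition OCP : {pred partial_map n} :=
  [pred a | contraction a && order_preserving a].

Definition ORCP : {pred partial_map n} :=
  [pred a | contraction a && (order_preserving a || order_reversing a)].

Lemma partial_map_relP (P : 'I_n -> 'I_n -> 'I_n -> 'I_n -> bool) a :
  reflect (forall x y u v, a x = Some u -> a y = Some v -> P x y u v)
    [forall x, forall y, forall u, forall v,
      (a x == Some u) && (a y == Some v) ==> P x y u v].
Proof.
apply: (iffP idP) => [/forallP H x y u v au av | H].
  move: (H x) => /forallP/(_ y)/forallP/(_ u)/forallP/(_ v).
  by rewrite au av !eqxx.
apply/forallP=> x; apply/forallP=> y; apply/forallP=> u; apply/forallP=> v.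
by apply/implyP=> /andP[/eqP au /eqP av]; apply: H.
Qed.

Lemma partial_map_mul_SomeP a b x w :
  (a * b) x = Some w -> exists2 u, a x = Some u & b u = Some w.
Proof. by rewrite partial_map_mulE; case: (a x) => //= u; exists u. Qed.

Lemma contractionM a b : contraction a -> contraction b -> contraction (a * b).
Proof.
move=> /partial_map_relP ca /partial_map_relP cb; apply/partial_map_relP.
move=> x y u v /partial_map_mul_SomeP[u' au bu].
move=> /partial_map_mul_SomeP[v' av bv].
exact: leq_trans (cb _ _ _ _ bu bv) (ca _ _ _ _ au av).
Qed.

Lemma order_mulP (r s t : rel nat) a b :
  (forall x y u v, a x = Some u -> a y = Some v -> r x y ==> s u v) ->
  (forall x y u v, b x = Some u -> b y = Some v -> s x y ==> t u v) ->
  forall x y u v, (a * b) x = Some u -> (a * b) y = Some v -> r x y ==> t u v.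
Proof.
move=> ha hb x y u v.
move=> /partial_map_mul_SomeP[u' au bu] /partial_map_mul_SomeP[v' av bv].
apply/implyP=> xy; apply: (implyP (hb _ _ _ _ bu bv)).
exact: (implyP (ha _ _ _ _ au av)).
Qed.

Lemma opM a b :
  order_preserving a -> order_preserving b -> order_preserving (a * b).
Proof.
move=> /partial_map_relP ha /partial_map_relP hb; apply/partial_map_relP.
exact: (order_mulP (r := leq) (s := leq) (t := leq)).
Qed.

Lemma op_orM a b :
  order_preserving a -> order_reversing b -> order_reversing (a * b).
Proof.
move=> /partial_map_relP ha /partial_map_relP hb; apply/partial_map_relP.
exact: (order_mulP (r := leq) (s := leq) (t := geq)).
Qed.

Lemma or_opM a b :
  order_reversing a -> order_preserving b -> order_reversing (a * b).
Proof.
move=> /partial_map_relP ha /partial_map_relP hb; apply/partial_map_relP.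
apply: (order_mulP (r := leq) (s := geq) (t := geq)) => // x y u v bx by_.
exact: hb.
Qed.

Lemma orM a b :
  order_reversing a -> order_reversing b -> order_preserving (a * b).
Proof.
move=> /partial_map_relP ha /partial_map_relP hb; apply/partial_map_relP.
apply: (order_mulP (r := leq) (s := geq) (t := leq)) => // x y u v bx by_.
exact: hb.
Qed.

Fact CP_mulg_closed : mulg_closed CP.
Proof. by move=> a b; rewrite !inE; apply: contractionM. Qed.

Fact OCP_mulg_closed : mulg_closed OCP.
Proof.
move=> a b; rewrite !inE => /andP[ca oa] /andP[cb ob].
by rewrite contractionM ?opM.
Qed.

Fact ORCP_mulg_closed : mulg_closed ORCP.
Proof.
move=> a b; rewrite !inE => /andP[ca oa] /andP[cb ob].
rewrite contractionM //=; apply/orP.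
case/orP: oa => oa; case/orP: ob => ob.
- by left; apply: opM.
- by right; apply: op_orM.
- by right; apply: or_opM.
- by left; apply: orM.
Qed.

End PartialMaps.

Arguments CP n : clear implicits.
Arguments OCP n : clear implicits.
Arguments ORCP n : clear implicits.

HB.instance Definition _ n :=
  isMulClosed.Build (partial_map n) (CP n) (@CP_mulg_closed n).
HB.instance Definition _ n :=
  isMulClosed.Build (partial_map n) (OCP n) (@OCP_mulg_closed n).
HB.instance Definition _ n :=
  isMulClosed.Build (partial_map n) (ORCP n) (@ORCP_mulg_closed n).

(* Main.v *)
(* Testing against partial identities recovers the image, and testing against
   constant maps and the empty map recovers the kernel. For (iv), relabelling
   the points of Im a by their rank in Im a is an order preserving contraction,
   so it takes a, within its R*-class, to a map with image {0, ..., |Im a| - 1};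
   maps of equal rank thus meet in a common L*-class. *)
From Stdlib Require Import Relation_Operators.
Require Import Defs.
From mathcomp Require Import all_boot.
From mathcomp Require Import ssrint zify.

Set Implicit Arguments.
Unset Strict Implicit.
Unset Printing Implicit Defensive.

Import IntDist.
Local Open Scope group_scope.

(** * Products, kernels and images of partial maps *)

Section PartialMapFacts.
Variable n : nat.
Implicit Types (a b c d : partial_map n) (A : {set 'I_n}) (i x y u v : 'I_n).

Lemma ImP a y : reflect (exists x, a x = Some y) (y \in Im a).
Proof.
by rewrite inE; apply: (iffP existsP) => -[x /eqP]; exists x => //; apply/eqP.
Qed.

(** A product with [a] on the left sees the other factor only on [Im a], so cancellation on this
    side depends on [a] only through its image. *)
Lemma eq_mull_Im a c d :
  a * c = a * d <-> forall y, y \in Im a -> c y = d y.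
Proof.
split=> [/ffunP acd y /ImP[x ax] | cd].
  by move: (acd x); rewrite !partial_map_mulE ax.
apply/ffunP=> x; rewrite !partial_map_mulE.
by case ax: (a x) => [y|] //=; apply: cd; apply/ImP; exists x.
Qed.

(* Ranging over [option 'I_n] makes kernels remember domains: [obind a None]
   is [None]. *)
Lemma eq_KerP a b :
  Ker a = Ker b <->
  forall s t : option 'I_n, obind a s = obind a t <-> obind b s = obind b t.
Proof.
split=> [/setP eK | eK].
  (* A diagonal pair lies in the kernel exactly when its point lies in the domain. *)
  have eD x : (a x == None) = (b x == None).
    move: (eK (x, x)); rewrite !inE /= !eqxx !andbT !andbb.
    exact: negb_inj.
  have eE x y : (a x == a y) = (b x == b y).
    move: (eK (x, y)) (eD x) (eD y); rewrite !inE /=.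
    by case: (a x) => [?|]; case: (a y) => [?|]; case: (b x) => [?|];
      case: (b y).
  move=> s t; suff E: (obind a s == obind a t) = (obind b s == obind b t).
    by split=> /eqP; [rewrite E | rewrite -E] => /eqP.
  case: s => [x|]; case: t => [y|] //=.
  by rewrite eq_sym eD eq_sym.
have eb (s t : option 'I_n) :
    (obind a s == obind a t) = (obind b s == obind b t).
  by apply/eqP/eqP; apply eK.
apply/setP=> -[x y]; rewrite !inE /=.
by rewrite (eb (Some x) (Some y)) (eb (Some x) None) (eb (Some y) None).
Qed.

Lemma eq_mulr_Ker a b c d :
  Ker a = Ker b -> (c * a = d * a <-> c * b = d * b).
Proof.
move/eq_KerP=> eK.
by split=> /ffunP e; apply/ffunP=> x; move: (e x);
  rewrite !partial_map_mulE => /eK.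
Qed.

(** Sending a value of [b] to the value of [a] at a chosen [b]-preimage covers [Im a], and equal
    kernels make the choice immaterial. The default in [odflt] is never reached on [Im b]. *)
Lemma leq_card_Im_Ker a b : Ker a = Ker b -> #|Im a| <= #|Im b|.
Proof.
move/eq_KerP=> eK; pose h y := a (odflt y [pick x | b x == Some y]).
(* Since [h] is option-valued, [Im a] is first replaced by its copy under [Some]. *)
rewrite -(card_imset _ (@Some_inj _)).
apply: leq_trans (leq_imset_card h (mem (Im b))).
apply/subset_leq_card/subsetP=> _ /imsetP[y /ImP[x ax] ->].
have [_ eN] := eK (Some x) None.
have [z bx]: exists z, b x = Some z.
  by case bx: (b x) => [z|]; [exists z | move: (eN bx); rewrite /= ax].
apply/imsetP; exists z; first by apply/ImP; exists x.
rewrite /h; case: pickP => [x' /eqP bx' | /(_ x)]; last by rewrite bx eqxx.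
by rewrite -ax; apply/(eK (Some x) (Some x')); rewrite /= bx bx'.
Qed.

Lemma eq_card_Im_Ker a b : Ker a = Ker b -> #|Im a| = #|Im b|.
Proof. by move=> e; apply/eqP; rewrite eqn_leq !leq_card_Im_Ker. Qed.

(** * Test maps: partial identities and constants *)

Definition pid A : partial_map n := [ffun x => if x \in A then Some x else None].
(** The value [None] gives the empty map, which will detect points outside a domain. *)
Definition pconst (s : option 'I_n) : partial_map n := [ffun=> s].

Lemma pidE A x : pid A x = if x \in A then Some x else None.
Proof. exact: ffunE. Qed.

Lemma pconstE s x : pconst s x = s.
Proof. exact: ffunE. Qed.

Lemma mul1pm a : pid setT * a = a.
Proof. by apply/ffunP=> x; rewrite partial_map_mulE pidE inE. Qed.

Lemma mulpm1 a : a * pid setT = a.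
Proof.
apply/ffunP=> x; rewrite partial_map_mulE -[RHS]/(a x).
by case: (a x) => //= y; rewrite pidE inE.
Qed.

Lemma pid_OCP A : pid A \in OCP n.
Proof.
rewrite inE; apply/andP; split; apply/partial_map_relP=> x y u v;
  rewrite !pidE; case: ifP => // _ [<-]; case: ifP => // _ [<-] //.
exact: implybb.
Qed.

Lemma pconst_OCP s : pconst s \in OCP n.
Proof.
rewrite inE; apply/andP; split; apply/partial_map_relP=> x y u v;
  rewrite !pconstE => -> [->]; first by rewrite distnn.
by rewrite leqnn implybT.
Qed.

Lemma mul_pconst s a x : (pconst s * a) x = obind a s.
Proof. by rewrite partial_map_mulE pconstE. Qed.

(** * Relabelling a subset by rank *)

Definition rank A (x : nat) : nat := #|[set z in A | z < x]|.

Lemma leq_rank A (x y : nat) : x <= y -> rank A x <= rank A y.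
Proof.
move=> xy; apply/subset_leq_card/subsetP=> z.
by rewrite !inE => /andP[-> zx] /=; apply: leq_trans xy.
Qed.

(** Passing [x] counts it exactly when it lies in [A]. The successor may equal [n], which is why
    [rank] takes a natural number and not an ordinal. *)
Lemma rankS A x : rank A x.+1 = rank A x + (x \in A).
Proof.
rewrite /rank; case xA: (x \in A).
  rewrite addn1 (cardsD1 x) !inE xA ltnSn add1n; congr _.+1; apply: eq_card=> z.
  by rewrite !inE -val_eqE /=; case: (z \in A); rewrite ?andbF //=; lia.
rewrite addn0; apply: eq_card=> z; rewrite !inE.
case: (eqVneq z x) => [->|]; first by rewrite xA.
by rewrite -val_eqE; case: (z \in A) => //=; lia.
Qed.

Lemma ltn_rank A x (y : nat) : x \in A -> x < y -> rank A x < rank A y.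
Proof.
by move=> xA xy; rewrite (leq_trans _ (leq_rank A xy)) // rankS xA addn1.
Qed.

(** Each unit step adds at most one to the rank; this is what makes [rank_map] a contraction. *)
Lemma rank_leqD A (x k : nat) : x + k <= n -> rank A (x + k) <= rank A x + k.
Proof.
elim: k => [|k IHk]; first by rewrite !addn0.
rewrite addnS => xkn; have := rankS A (Ordinal xkn); rewrite /= => ->.
by rewrite addnS -addn1 leq_add ?leq_b1 // IHk // ltnW.
Qed.

Lemma rank_ltn A x : x \in A -> rank A x < #|A|.
Proof.
move=> xA; have -> : #|A| = rank A n.
  by apply: eq_card => z; rewrite !inE ltn_ord andbT.
exact: ltn_rank.
Qed.

Lemma rank_ltn_ord A x : rank A x < n.
Proof.
rewrite -[ltnRHS]card_ord -cardsT; apply/proper_card/properP.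
by split; [exact: subsetT | exists x; rewrite !inE ?ltnn ?andbF].
Qed.

Definition rank_map A : partial_map n :=
  [ffun x => if x \in A then Some (Ordinal (rank_ltn_ord A x)) else None].

Lemma rank_mapE A x :
  rank_map A x = if x \in A then Some (Ordinal (rank_ltn_ord A x)) else None.
Proof. exact: ffunE. Qed.

Lemma rank_map_OCP A : rank_map A \in OCP n.
Proof.
have dist x y : x <= y -> rank A y <= rank A x + (y - x).
  by move=> xy; rewrite -{1}(subnKC xy) rank_leqD // subnKC // ltnW.
rewrite inE; apply/andP; split; apply/partial_map_relP=> x y u v;
  rewrite !rank_mapE; case: ifP => // xA [<-]; case: ifP => // yA [<-] /=.
  (* Both orders of [x] and [y] are supplied, as the distances are absolute values. *)
  have := dist x y; have := dist y x; have := @leq_rank A x y.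
  have := @leq_rank A y x; lia.
by apply/implyP; apply: leq_rank.
Qed.

Lemma rank_map_inj A x y :
  x \in A -> y \in A -> rank_map A x = rank_map A y -> x = y.
Proof.
move=> xA yA; rewrite !rank_mapE xA yA => -[/= e]; apply: val_inj => /=.
have := @ltn_rank A x y xA; have := @ltn_rank A y x yA; lia.
Qed.

(** The relabelling is defined and injective on all of [Im a], so composing with it neither loses
    domain points nor identifies values. *)
Lemma Ker_mul_rank_map a : Ker (a * rank_map (Im a)) = Ker a.
Proof.
set r := rank_map _.
have mulE (s : option 'I_n) :
    obind (a * r : partial_map n) s = obind r (obind a s).
  by case: s => //= x; apply: partial_map_mulE.
have rE y : y \in Im a -> r y = None -> False by rewrite rank_mapE => ->.
have aI (s : option 'I_n) y : obind a s = Some y -> y \in Im a.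
  by case: s => //= x ax; apply/ImP; exists x.
apply/eq_KerP=> s t; rewrite !mulE; split=> [|-> //].
case as_: (obind a s) => [u|]; case at_: (obind a t) => [v|] //=.
- by move/(rank_map_inj (aI _ _ as_) (aI _ _ at_))=> ->.
- by move/rE; case; apply: aI as_.
- by move/esym/rE; case; apply: aI at_.
Qed.

(** Ranks of points of [Im a] fall below [#|Im a|]; equality then follows by counting, since the
    unchanged kernel fixes the size of the image. *)
Lemma Im_mul_rank_map a :
  Im (a * rank_map (Im a)) = [set i : 'I_n | i < #|Im a|].
Proof.
apply/eqP; rewrite eqEcard; apply/andP; split.
  apply/subsetP=> i /ImP[x /partial_map_mul_SomeP[u _]].
  by rewrite rank_mapE; case: ifP => // uI [<-]; rewrite inE; apply: rank_ltn.
rewrite (eq_card_Im_Ker (Ker_mul_rank_map a)).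
have leIn : #|Im a| <= n by rewrite -[leqRHS]card_ord max_card.
by rewrite -sum1dep_card -(big_ord_widen _ (fun=> 1%N) leIn) sum1_card card_ord.
Qed.

End PartialMapFacts.

(** * Starred relations on a semigroup containing [OCP n] *)

Section StarredGreenContractions.
Variables (n : nat) (S : mulgClosed (partial_map n)).
Hypothesis OCP_S : {subset OCP n <= S}.
Implicit Types a b : subsemigroup S.

Definition sub_OCP (c : partial_map n) (c_OCP : c \in OCP n) : subsemigroup S :=
  exist _ c (OCP_S c_OCP).

(** The full identity [pid setT] lies in [S], so nothing is adjoined and multipliers range over [S]
    itself. *)
Lemma in_S1_Some (x : option (subsemigroup S)) : in_S1 x -> exists s, x = Some s.
Proof.
case: x => [s|[]]; first by exists s.
by exists (sub_OCP (pid_OCP setT)) => s; split; apply: val_inj;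
  [exact: mul1pm | exact: mulpm1].
Qed.

(** The partial identity on [Im a] and the full identity agree after [a]; transferred to [b], this
    says that every point of [Im b] lies in [Im a]. *)
Lemma Lstar_Im a b : Lstar a b <-> Im (val a) = Im (val b).
Proof.
have sub_Im a' b' : Lstar a' b' -> {subset Im (val b') <= Im (val a')}.
  move=> Lab; pose A := Im (val a').
  have [e _] :=
    Lab (Some (sub_OCP (pid_OCP A))) (Some (sub_OCP (pid_OCP setT))) I I.
  have /e/(congr1 val)/eq_mull_Im eA :
      a' * sub_OCP (pid_OCP A) = a' * sub_OCP (pid_OCP setT).
    by apply: val_inj; apply/eq_mull_Im => y yA; rewrite !pidE yA inE.
  by move=> y /eA; rewrite !pidE in_setT; case: ifP.
split=> [Lab | eI].
  apply/setP=> y; apply/idP/idP; apply: sub_Im => //.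
  by move=> x y' Sx Sy; apply: iff_sym; apply: Lab.
move=> _ _ /in_S1_Some[x ->] /in_S1_Some[y ->] /=.
by split=> /(congr1 val)/eq_mull_Im e; apply: val_inj; apply/eq_mull_Im;
  rewrite ?eI // -eI.
Qed.

(** A constant map followed by [c] is constant with value [obind c s], so equating two such products
    tests whether [c] agrees at two points, or is undefined at one when the other is [None]. *)
Lemma Rstar_Ker a b : Rstar a b <-> Ker (val a) = Ker (val b).
Proof.
split=> [Rab | eK].
  (* The value of a constant map is read off at a point [x0]; over an empty chain all kernels are
     empty. *)
  have [x0 _ | no_x] := pickP (@predT 'I_n); last first.
    by apply/setP=> -[x y]; have := no_x x.
  apply/eq_KerP=> s t.
  have Est (c : subsemigroup S) : obind (val c) s = obind (val c) t <->
      sub_OCP (pconst_OCP s) * c = sub_OCP (pconst_OCP t) * c.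
    split=> [e | /(congr1 val)/ffunP/(_ x0)].
      by apply/val_inj/ffunP=> x; rewrite [LHS]mul_pconst [RHS]mul_pconst.
    by rewrite [LHS]mul_pconst [RHS]mul_pconst.
  have :=
    Rab (Some (sub_OCP (pconst_OCP s))) (Some (sub_OCP (pconst_OCP t))) I I.
  by rewrite /= !Est.
move=> _ _ /in_S1_Some[x ->] /in_S1_Some[y ->] /=.
by split=> /(congr1 val) e; apply: val_inj; move: e; apply eq_mulr_Ker.
Qed.

(** Both generating relations preserve the size of the image. Conversely, the chain [a], [r a],
    [r b], [b] uses [Rstar], [Lstar], [Rstar] in turn. *)
Lemma Dstar_card_Im a b : Dstar a b <-> #|Im (val a)| = #|Im (val b)|.
Proof.
split=> [|eI].
  elim=> // [c d [/Lstar_Im -> // | /Rstar_Ker/eq_card_Im_Ker //] | c d e _ -> _ -> //].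
pose r c := c * sub_OCP (rank_map_OCP (Im (val c))) : subsemigroup S.
have Rr c : Dstar (r c) c.
  by apply: rst_step; right; apply/Rstar_Ker; apply: Ker_mul_rank_map.
apply: (rst_trans _ _ _ (r a)); first exact/rst_sym/Rr.
apply: (rst_trans _ _ _ (r b)); last exact: Rr.
apply: rst_step; left; apply/Lstar_Im.
by rewrite [LHS]Im_mul_rank_map [RHS]Im_mul_rank_map eI.
Qed.

End StarredGreenContractions.

Theorem theorem2p1 (n : nat) (n_ge1 : (1 <= n)%N) (S : mulgClosed (partial_map n))
    (S_cases : [\/ S = CP n, S = ORCP n | S = OCP n])
    (a b : subsemigroup S) :
  [/\ Lstar a b <-> Im (val a) = Im (val b),
      Rstar a b <-> Ker (val a) = Ker (val b),
      Hstar a b <-> Im (val a) = Im (val b) /\ Ker (val a) = Ker (val b)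
    & Dstar a b <-> #|Im (val a)| = #|Im (val b)|].
Proof.
(* All multipliers constructed above lie in [OCP n], so this inclusion treats the three semigroups
   at once. *)
have OCP_S : {subset OCP n <= S}.
  by case: S_cases => -> c; rewrite !inE // => /andP[-> // ->].
split; [exact: Lstar_Im | exact: Rstar_Ker | | exact: Dstar_card_Im].
by rewrite /Hstar Lstar_Im // Rstar_Ker.
Qed.
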